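(* Assume that Artin's conjecture fails at $s_0$, with the characters ordered so that, for integers $1\le p<q\le r$, one has $\ell_1,\ldots,\ell_p>0$, $\ell_{p+1},\ldots,\ell_q<0$, $\ell_{q+1}=\cdots=\ell_r=0$. Assume that $f_1,\ldots,f_p$ have simple zeros at $s_0$. Then $$\mathbb F[H(s_0)]=\mathbb F[x_1,\ldots,x_p,\,x_{q+1},\ldots,x_r,\ vx_j\;:\;p+1\le j\le q,\ v\text{ a monomial},\ \operatorname{supp}(v)\subset\{x_1,\ldots,x_p\},\ \deg(v)=-\ell_j].$$
   Context: Let $K/\mathbb Q$ be a finite Galois extension with Galois group $G$, let $\chi_1,\ldots,\chi_r$ be the irreducible complex characters of $G$, and let $f_j(s)=L(s,\chi_j,K/\mathbb Q)$, $1\le j\le r$, be their Artin L-functions (meromorphic on $\mathbb C$). Fix $s_0\in\mathbb C\setminus\{1\}$ and let $\ell_j:=\operatorname{ord}_{s=s_0}f_j\in\mathbb Z$ be the order of $s_0$ as a zero of $f_j$ (negative if $f_j$ has a pole at $s_0$). Artin's conjecture at $s_0$ is the statement that $f_1,\ldots,f_r$ are all holomorphic at $s_0$; if it fails, some $\ell_j$ is negative and some $\ell_j$ is positive (because the Dedekind zeta function $\zeta_K=\prod_j f_j^{\chi_j(1)}$ is holomorphic at $s_0$), so an ordering as in the claim exists. Let $\mathbb F$ be a field with $\mathbb C\subseteq\mathbb F\subseteq\mathcal M_{<1}$, where $\mathcal M_{<1}$ is the field of meromorphic functions on $\mathbb C$ of order $<1$. Let $H(s_0)$ be the set of $(a_1,\ldots,a_r)\in\mathbb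 N^r$ (with $0\in\mathbb N$) such that $f_1^{a_1}\cdots f_r^{a_r}$ is holomorphic at $s_0$, i.e. $H(s_0)=\{a\in\mathbb N^r: a_1\ell_1+\cdots+a_r\ell_r\ge 0\}$. Let $\mathbb F[H(s_0)]\subseteq\mathbb F[x_1,\ldots,x_r]$ be the $\mathbb F$-subalgebra spanned by the monomials $x_1^{a_1}\cdots x_r^{a_r}$ with $(a_1,\ldots,a_r)\in H(s_0)$. The support of a monomial $v$ is $\operatorname{supp}(v):=\{x_j: x_j\mid v\}$, and $\deg(v)$ is its total degree. *)

(* Defs.v *)
From HB Require Import structures.
From mathcomp Require Import all_boot all_order all_algebra all_fingroup.
From mathcomp Require Import all_field all_character.
From mathcomp Require Import all_classical all_reals all_analysis.
From mathcomp Require Import complex.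
(* The notations of mpoly clash with those of MathComp-Analysis. *)
From mathcomp Require Import -(notations) mpoly.

Set Implicit Arguments.
Unset Strict Implicit.
Unset Printing Implicit Defensive.

Import Order.TTheory GRing.Theory Num.Theory.
Import numFieldNormedType.Exports.

Local Open Scope classical_set_scope.
Local Open Scope ring_scope.

(* A meromorphic function on C is represented by a total function C -> C. Its
   values on a closed discrete set (poles, removable singularities) are
   irrelevant: everything below depends on punctured neighbourhoods only, and
   two representatives of the same meromorphic function are related by
   eq_mero. In this section C is an arbitrary numFieldType; it is instantiated
   with the complex numbers R[i]. *)
Section Meromorphic.
Variable C : numFieldType.
Implicit Types (f g : C -> C) (z : C).

Definition analytic_near g z := \forall w \near z, derivable g w 1.

Definition holomorphic_at f z :=
  exists2 g, analytic_near g z & \forall w \near z^', f w = g w.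

Definition meromorphic f := forall z, exists n : nat,
  exists2 g, analytic_near g z & \forall w \near z^', f w = g w / (w - z) ^+ n.

Definition eq_mero f g := forall z, \forall w \near z^', f w = g w.

(* l is the order of vanishing of f at z (negative at a pole) *)
Definition has_order f z (l : int) := exists g,
  [/\ analytic_near g z, g z != 0 & \forall w \near z^', f w = (w - z) ^ l * g w].

Definition pole_order f z : nat :=
  xget 0%N [set k | (0 < k)%N /\ has_order f z (- k%:Z)].

End Meromorphic.

(* Growth order of a meromorphic function, from the Nevanlinna characteristic
   T(r, f) = m(r, f) + N(r, f). *)
Section Nevanlinna.
Variable R : realType.
Implicit Types (f : R[i] -> R[i]) (r t x : R).

Definition cabs (z : R[i]) : R := complex.Re `|z|.

Definition cexp (z : R[i]) : R[i] :=
  Complex (expR (complex.Re z) * cos (complex.Im z))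
          (expR (complex.Re z) * sin (complex.Im z)).

Definition logp x : R := ln (Num.max 1 x).

Definition proximity f r : R := (2 * pi)^-1 *
  \int[lebesgue_measure]_(x in `[0, 2 * pi]) logp (cabs (f (r%:C%C * cexp (Complex 0 x)))).

Definition pole_count f t : R :=
  \sum_(z \in [set z : R[i] | cabs z <= t]) ((pole_order f z)%:R : R).

Definition pole_counting f r : R :=
  \int[lebesgue_measure]_(t in `[0, r]) ((pole_count f t - pole_count f 0) / t)
  + pole_count f 0 * ln r.

Definition characteristic f r : R := proximity f r + pole_counting f r.

Definition growth_order f : \bar R :=
  limf_esup (fun r => (logp (characteristic f r) / ln r)%:E) (pinfty_nbhs R).

(* The field F, through phi, is a field of (classes modulo eq_mero of)
   meromorphic functions of order < 1 that contains the constants. *)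
Record between_C_and_Mlt1 (F : fieldType) (phi : F -> R[i] -> R[i]) : Prop := {
  Mlt1_mero : forall a, meromorphic (phi a);
  Mlt1_order : forall a, (growth_order (phi a) < 1)%E;
  Mlt1_inj : forall a b, eq_mero (phi a) (phi b) -> a = b;
  Mlt1_one : eq_mero (phi 1) (fun=> 1);
  Mlt1_add : forall a b, eq_mero (phi (a + b)) (fun z => phi a z + phi b z);
  Mlt1_mul : forall a b, eq_mero (phi (a * b)) (fun z => phi a z * phi b z);
  Mlt1_const : forall c : R[i], exists a, eq_mero (phi a) (fun=> c) }.

End Nevanlinna.

Section ArtinL.
Variables (R : realType) (K : splittingFieldType rat).
Local Notation gT := (gal_of {:K}).
Local Notation G := 'Gal({:K} / 1)%G.

Definition ring_of_integers : set K :=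
  [set x | integralOver (intr : int -> K) x].

Definition prime_above (p : nat) (P : set K) :=
  [/\ P `<=` ring_of_integers, P p%:R, ~ P 1,
      (forall x y, P x -> P y -> P (x + y)) /\
      (forall x y, ring_of_integers x -> P y -> P (x * y)) &
      forall x y, ring_of_integers x -> ring_of_integers y ->
        P (x * y) -> P x \/ P y].

(* The congruences below force s to stabilise P, so that the decomposition
   group of P need not be mentioned. *)
Definition inertia (P : set K) : {set gT} :=
  [set s in G | `[< forall x, ring_of_integers x -> P (s x - x) >]]%SET.

Definition is_frobenius (p : nat) (P : set K) (s : gT) :=
  s \in G /\ forall x, ring_of_integers x -> P (s x - x ^+ p).

(* MathComp representations act on row vectors and the product s * t of gT is
   "s, then t", so that a row vector v is mapped by s to v *m rG s in a genuine
   left action of the usual Galois group; V^I is the row space of rfix_mx. The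
   factor does not depend on the choice of P above p and of a Frobenius. *)
Definition euler_factor n (rG : mx_representation R[i] G n) (p : nat)
    (s : R[i]) : R[i] :=
  let P := xget set0 [set P | prime_above p P] in
  let frob := xget 1%g [set x : gT | is_frobenius p P x] in
  let V := rfix_mx rG (inertia P) in
  (\det (1%:M - cexp (- s * (ln p%:R)%:C)%C
                  *: in_submod V (val_submod 1%:M *m rG frob)))^-1.

Definition affords n (rG : mx_representation R[i] G n) (chi : gT -> R[i]) :=
  forall x, chi x = \tr (rG x).

Definition irreducible_characters : set (gT -> R[i]) :=
  [set chi | exists n (rG : mx_representation R[i] G n),
               mx_irreducible rG /\ affords rG chi].

(* L(s, chi, K/Q), up to eq_mero: the meromorphic function on C given by the
   Euler product for Re s > 1 *)
Definition is_artin_L (chi : gT -> R[i]) (f : R[i] -> R[i]) :=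
  meromorphic f /\
  exists n (rG : mx_representation R[i] G n), affords rG chi /\
    forall s : R[i], 1 < complex.Re s ->
      (\prod_(p < N | prime p) euler_factor rG p s) @[N --> \oo]
        --> (f s : R[i]^o).

End ArtinL.

Definition holomorphy_monoid (C : numFieldType) (r : nat)
    (f : 'I_r -> C -> C) (s0 : C) : set (multinom r) :=
  [set a | holomorphic_at (fun z => \prod_(j < r) f j z ^+ a j) s0].

Section Subalgebras.
Variables (F : fieldType) (r : nat).

Definition monomial_span (H : set (multinom r)) : set (mpoly r F) :=
  smallest [set A : set (mpoly r F) | GRing.submod_closed (mem A)]
           ((@mpolyX r F) @` H).

Definition generated_subalgebra (S : set (mpoly r F)) : set (mpoly r F) :=
  smallest [set A : set (mpoly r F) | GRing.subalg_closed (mem A)] S.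

Definition variable (j : 'I_r) : mpoly r F := mpolyX F (mnm1 j).

End Subalgebras.

Arguments irreducible_characters R K _ : clear implicits.
Arguments monomial_span F {r} H.
Arguments variable F {r} j.

Definition msupport (r : nat) (v : multinom r) : set 'I_r :=
  [set j | (0 < v j)%N].

(* Main.v *)
Require Import Defs.
From HB Require Import structures.
From mathcomp Require Import all_boot all_order all_algebra all_fingroup.
From mathcomp Require Import all_field all_character.
From mathcomp Require Import all_classical all_reals all_analysis.
From mathcomp Require Import complex.
From mathcomp Require Import -(notations) mpoly.

Set Implicit Arguments.
Unset Strict Implicit.
Unset Printing Implicit Defensive.

Import Order.TTheory GRing.Theory Num.Theory.
Import numFieldNormedType.Exports.

Local Open Scope classical_set_scope.
Local Open Scope ring_scope.

(** By additivity of orders of vanishing, a product [f_1^a_1 ... f_r^a_r] has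
    order [a_1 ell_1 + ... + a_r ell_r] at [s0], and a function with an order
    at [s0] is holomorphic there exactly when that order is nonnegative. Hence [H(s0)] is the
    monoid of exponents of nonnegative weight ([has_order_prod],
    [has_order_holomorphicP]), and the statement is about generators of this
    monoid.

    Let [a] have nonnegative weight. If no variable of negative weight occurs
    in [a], then [a] is a sum of unit exponents of nonnegative weight. Otherwise
    let [x_j] occur in [a] with [ell j < 0]. As the positive weights are all
    equal to 1, the part of [a] on the variables of positive weight has degree
    at least [- ell j], so some [v <= a] supported there has degree exactly
    [- ell j] ([exists_submultinom]). Then [v + U_j <= a] has weight 0, so the
    remainder [a - (v + U_j)] still has nonnegative weight and smaller degree,
    and induction applies ([weight_monoid_ind]).

    Conversely all the generators are monomials with exponents in [H(s0)], and
    the span of the monomials with exponents in a monoid is a subalgebra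
    ([monomial_span_subalg_closed]). *)

(** * Orders of vanishing *)

Section OrderOfVanishing.
Variable C : numFieldType.
Implicit Types (f g : C -> C) (z : C) (l m : int).

Lemma analytic_near_continuous g z : analytic_near g z -> {for z, continuous g}.
Proof.
move=> /nbhs_singleton dg.
by apply: differentiable_continuous; apply/derivable1_diffP.
Qed.

Lemma analytic_nearM f g z :
  analytic_near f z -> analytic_near g z -> analytic_near (f * g) z.
Proof. by apply: filterS2 => w; exact: derivableM. Qed.

Lemma analytic_near_shift_exp z n :
  analytic_near ((id - cst z) ^+ n : C -> C) z.
Proof.
near=> w.
have dB : derivable (id - cst z : C -> C) w 1.
  by apply: derivableB; [exact: derivable_id|exact: derivable_cst].
exact: derivableX.
Unshelve. all: by end_near. Qed.

Lemma has_order1 z : has_order (fun=> 1 : C) z 0.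
Proof.
exists (fun=> 1); split; [|exact: oner_neq0|].
- by near=> w; exact: derivable_cst.
- by near=> w; rewrite expr0z mulr1.
Unshelve. all: by end_near. Qed.

Lemma has_orderM f g z l m : has_order f z l -> has_order g z m ->
  has_order (fun w => f w * g w) z (l + m).
Proof.
move=> [f1 [af f1z fE]] [g1 [ag g1z gE]].
exists (f1 * g1); split; [exact: analytic_nearM|exact: mulf_neq0|].
near=> w.
have wz : w - z != 0 by rewrite subr_eq0; near: w; exact: nbhs_dnbhs_neq.
rewrite (near fE w)// (near gE w)// expfzDr// [(f1 * g1) w]/GRing.mul/=.
by rewrite mulrACA.
Unshelve. all: by end_near. Qed.

Lemma has_orderX f z l n : has_order f z l ->
  has_order (fun w => f w ^+ n) z (l *+ n).
Proof.
move=> fl; elim: n => [|n IHn]; first exact: has_order1.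
rewrite mulrS (_ : (fun _ => _) = fun w => f w * f w ^+ n).
  exact: has_orderM.
by apply/funext => w; rewrite exprS.
Qed.

Lemma has_order_prod (I : Type) (s : seq I) (f : I -> C -> C) z (l : I -> int) :
  (forall i, has_order (f i) z (l i)) ->
  has_order (fun w => \prod_(i <- s) f i w) z (\sum_(i <- s) l i).
Proof.
move=> fl; elim: s => [|i s IHs].
  rewrite big_nil (_ : (fun _ => _) = fun=> 1); first exact: has_order1.
  by apply/funext => w; rewrite big_nil.
rewrite big_cons (_ : (fun _ => _) = fun w => f i w * \prod_(j <- s) f j w).
  exact: has_orderM.
by apply/funext => w; rewrite big_cons.
Qed.

(** If [f] were holomorphic with a negative order [- n], then
    [(w - z) ^ n * f w] would have both the limit 0 and a nonzero limit
    at [z]. *)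
Lemma has_order_holomorphicP f z l : has_order f z l ->
  holomorphic_at f z <-> 0 <= l.
Proof.
move=> [g [ag gz fE]]; split; last first.
  case: l fE => // n fE _.
  exists ((id - cst z) ^+ n * g).
    exact: analytic_nearM (analytic_near_shift_exp z n) ag.
  by near=> w; rewrite (near fE w)// !fctE exprnP.
move=> [h ah fh]; case: l fE => // n fE; exfalso.
have gE : \forall w \near z^', g w = ((id - cst z) ^+ n.+1 * h) w.
  near=> w.
  have wz : w - z != 0 by rewrite subr_eq0; near: w; exact: nbhs_dnbhs_neq.
  rewrite !fctE -(near fh w)// (near fE w)// NegzE.
  by rewrite exprnP mulrA -expfzDr// subrr expr0z mul1r.
have/analytic_near_continuous/continuous_withinNx ch :=
  analytic_nearM (analytic_near_shift_exp z n.+1) ah.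
have /analytic_near_continuous/continuous_withinNx cg := ag.
have {}ch : g w @[w --> z^'] --> ((id - cst z) ^+ n.+1 * h) z.
  by apply: cvg_trans ch; apply: near_eq_cvg; near=> w; rewrite (near gE w).
move: gz; rewrite (cvg_unique (@norm_hausdorff _ _) cg ch) !fctE subrr.
by rewrite exprS !mul0r eqxx.
Unshelve. all: by end_near. Qed.

End OrderOfVanishing.

(** * Exponents of nonnegative weight *)

Section WeightMonoid.
Variables (r : nat) (ell : 'I_r -> int).
Implicit Types (a v : multinom r) (i j : 'I_r).

(** The weight of the exponent [a] when the [j]-th variable has weight
    [ell j]. *)
Definition weight a : int := \sum_j ell j *+ a j.

Lemma weightD a b : weight (mnm_add a b) = weight a + weight b.
Proof.
by rewrite -big_split; apply: eq_bigr => j _; rewrite mnmDE mulrnDr.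
Qed.

Lemma weight0 : weight mnm0 = 0.
Proof. by rewrite /weight big1// => j _; rewrite mnm0E. Qed.

Lemma weightU j : weight (mnm1 j) = ell j.
Proof.
rewrite /weight (bigD1 j)//= mnm1E eqxx big1 ?addr0// => i.
by rewrite mnm1E eq_sym => /negbTE->.
Qed.

Lemma weight_eq_mdeg v : (forall i, (0 < v i)%N -> ell i = 1) ->
  weight v = (mdeg v)%:Z.
Proof.
move=> v1; rewrite mdegE /weight -natz natr_sum; apply: eq_bigr => i _.
by have [->//|/v1->] := posnP (v i).
Qed.

(** Below [a] there are exponents supported in [A] of every degree up to that
    of the part of [a] on [A]. *)
Lemma exists_submultinom (A : pred 'I_r) a d : (d <= \sum_(i | A i) a i)%N ->
  exists v, [/\ lem v a, forall i, (0 < v i)%N -> A i & mdeg v = d].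
Proof.
elim: d => [_|d IHd lt_da].
  exists mnm0; split; last exact: mdeg0.
  - by apply/mnm_lepP => i; rewrite mnm0E.
  - by move=> i; rewrite mnm0E.
have [v [/mnm_lepP le_va vA vd]] := IHd (ltnW lt_da).
have [i Ai lt_vi] : exists2 i, A i & (v i < a i)%N.
  apply/exists2P; apply: contrapT => noi; move: lt_da; rewrite ltnNge => /negP.
  apply; rewrite -vd mdegE [leqRHS](bigID A)/=.
  apply: leq_trans (leq_addr _ _); apply: leq_sum => i Ai.
  by rewrite leqNgt; apply/negP => lt_vi; apply: noi; exists i.
exists (mnm_add v (mnm1 i)); split.
- apply/mnm_lepP => k; rewrite mnmDE mnm1E; case: eqP => [<-|_].
    by rewrite addn1.
  by rewrite addn0.
- move=> k; rewrite mnmDE mnm1E; case: eqP => [<-//|_].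
  by rewrite addn0; exact: vA.
- by rewrite mdegD mdeg1 vd addn1.
Qed.

(** Generation of the monoid of exponents of nonnegative weight, as an induction
    principle: besides the unit exponents of nonnegative weight, it is enough to
    have the [v + U_j] of weight 0 with [ell j < 0] and [v] supported in the
    variables of positive weight. *)
Lemma weight_monoid_ind (P : multinom r -> Prop) :
  (forall j, 0 < ell j -> ell j = 1) ->
  P mnm0 -> (forall a b, P a -> P b -> P (mnm_add a b)) ->
  (forall j, 0 <= ell j -> P (mnm1 j)) ->
  (forall j v, ell j < 0 -> (forall i, (0 < v i)%N -> 0 < ell i) ->
    (mdeg v)%:Z = - ell j -> P (mnm_add v (mnm1 j))) ->
  forall a, 0 <= weight a -> P a.
Proof.
move=> simple P0 PD Pge0 Plt0 a.
have [n] := ubnP (mdeg a); elim: n a => // n IHn a /ltnSE le_an wa.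
have [[j ja jlt0]|nolt0] := pselect (exists2 j, (0 < a j)%N & ell j < 0).
  (* The variables of nonpositive weight contribute at most ell j to the weight
     of a, since a j > 0. *)
  have le_d : (`|ell j| <= \sum_(i | (0 < ell i)%R) a i)%N.
    rewrite -lez_nat ltz0_abs// lerNl -subr_ge0 opprK addrC.
    apply: le_trans wa _; rewrite /weight (bigID [pred i | 0 < ell i])/=.
    rewrite (eq_bigr (fun i => (a i)%:R)) => [|i /simple->//].
    rewrite -natr_sum natz lerD2l (bigD1 j)/=; last by rewrite -leNgt ltW.
    rewrite -[leRHS]addr0 lerD//; last first.
      apply: sumr_le0 => i /andP[+ _]; rewrite -leNgt => le0.
      exact: mulrn_wle0.
    by rewrite -(prednK ja) mulrS gerDl mulrn_wle0 ?ltW.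
  have [v [le_va vpos vd]] := exists_submultinom le_d.
  have le_vja : lem (mnm_add v (mnm1 j)) a.
    apply/mnm_lepP => i; rewrite mnmDE mnm1E; case: eqP => [<-|_].
      have [/vpos/lt_trans/(_ jlt0)|] := ltnP 0 (v j); first by rewrite ltxx.
      by rewrite leqn0 => /eqP->.
    by rewrite addn0; exact: (mnm_lepP le_va).
  have vdZ : (mdeg v)%:Z = - ell j by rewrite vd ltz0_abs.
  rewrite -(submK le_vja); apply: (PD); last exact: Plt0.
  have mE := congr1 (@mdeg r) (submK le_vja); rewrite !mdegD mdeg1 in mE.
  apply: IHn.
    by apply: leq_trans le_an; rewrite -mE addn1 addnS ltnS leq_addr.
  move: wa; rewrite -{1}(submK le_vja) 2!weightD weightU.
  rewrite (weight_eq_mdeg (fun i vi => simple i (vpos i vi))) vdZ.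
  by rewrite addNr addr0.
rewrite [a]multinomUE_id; apply: (big_ind P) => // j _.
have [->|] := posnP (a j); first by rewrite mulm0n.
move=> aj; have jge0 : 0 <= ell j.
  by rewrite leNgt; apply/negP => ?; apply: nolt0; exists j.
elim: (a j) => [|k IHk]; rewrite ?mulm0n// mulmS.
by apply: PD => //; exact: Pge0.
Qed.

End WeightMonoid.

(** * Spans of monomials and generated subalgebras *)

Section Span.
Variables (F : fieldType) (r : nat).
Implicit Types (H : set (multinom r)) (S : set (mpoly r F)).

(** A polynomial is in the span exactly when its monomials have exponents
    in [H]. *)
Lemma monomial_spanE H : monomial_span F H =
  [set g | forall m, m \in msupp g -> H m].
Proof.
apply/seteqP; split.
  apply: smallest_sub => [|_ [m Hm <-] k]; last by rewrite msuppX inE => /eqP->.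
  split=> [|c g h]; rewrite !in_setE/=; first by rewrite msupp0.
  move=> Hg Hh m /msuppD_le; rewrite mem_cat.
  by move=> /orP[/msuppZ_le|]; [exact: Hg|exact: Hh].
move=> g Hg A [[A0 Alin] HA]; rewrite [g]mpolyE.
have {}HA m : m \in msupp g -> mpolyX F m \in mem A.
  by move=> /Hg Hm; rewrite in_setE; apply: HA; exists m.
rewrite -in_setE.
elim: (msupp g) HA => [|m s IHs] HA; first by rewrite big_nil.
rewrite big_cons; apply: Alin; first by rewrite HA ?mem_head.
by apply: IHs => k ks; rewrite HA// inE ks orbT.
Qed.

Lemma monomial_span_subalg_closed H : H mnm0 ->
  (forall a b, H a -> H b -> H (mnm_add a b)) ->
  GRing.subalg_closed (mem (monomial_span F H)).
Proof.
rewrite monomial_spanE => H0 HD; split=> [|c g h|g h]; rewrite !in_setE/=.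
- by move=> m; rewrite msupp1 inE => /eqP->.
- move=> Hg Hh m /msuppD_le; rewrite mem_cat.
  by move=> /orP[/msuppZ_le|]; [exact: Hg|exact: Hh].
- by move=> Hg Hh m /msuppM_le/allpairsP[[a b]/= [/Hg Ha /Hh Hb ->]]; exact: HD.
Qed.

Lemma mpolyX_monomial_span H m : H m -> monomial_span F H (mpolyX F m).
Proof. by move=> Hm; apply: sub_gen_smallest; exists m. Qed.

Lemma subalg_submod_closed (A : set (mpoly r F)) :
  GRing.subalg_closed (mem A) -> GRing.submod_closed (mem A).
Proof.
move=> [A1 Alin _]; split=> //.
by have := Alin (-1) _ _ A1 A1; rewrite scaleN1r addNr.
Qed.

Lemma generated_subalgebra_subalg_closed S :
  GRing.subalg_closed (mem (generated_subalgebra S)).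
Proof.
split=> [|c g h|g h]; rewrite !in_setE/=.
- by move=> A [[+ _ _] _]; rewrite in_setE.
- move=> Sg Sh A AS; have [[_ Alin _] _] := AS.
  by rewrite -in_setE; apply: Alin; rewrite in_setE; [exact: Sg|exact: Sh].
- move=> Sg Sh A AS; have [[_ _ AM] _] := AS.
  by rewrite -in_setE; apply: AM; rewrite in_setE; [exact: Sg|exact: Sh].
Qed.

End Span.

(** * The algebra of the monoid of holomorphy *)

Theorem proposition1p12
  (R : realType) (K : splittingFieldType rat)
  (galK : galois 1 {:K})
  (r : nat) (chi : 'I_r -> gal_of {:K} -> R[i])
  (chi_irr : set_bij [set: 'I_r] (irreducible_characters R K) chi)
  (f : 'I_r -> R[i] -> R[i])
  (fL : forall j, is_artin_L (chi j) (f j))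
  (s0 : R[i]) (s0_neq1 : s0 != 1)
  (ell : 'I_r -> int)
  (ell_ord : forall j, has_order (f j) s0 (ell j))
  (F : fieldType) (phi : F -> R[i] -> R[i])
  (F_between : between_C_and_Mlt1 phi)
  (artin_fails : ~ (forall j, holomorphic_at (f j) s0))
  (p q : nat) (p_ge1 : (1 <= p)%N) (p_lt_q : (p < q)%N) (q_le_r : (q <= r)%N)
  (ell_pos : forall j : 'I_r, (j < p)%N -> 0 < ell j)
  (ell_neg : forall j : 'I_r, (p <= j < q)%N -> ell j < 0)
  (ell_zero : forall j : 'I_r, (q <= j)%N -> ell j = 0)
  (simple_zeros : forall j : 'I_r, (j < p)%N -> ell j = 1) :
  monomial_span F (holomorphy_monoid f s0) =
  generated_subalgebra
    ([set variable F j | j in [set j : 'I_r | (j < p)%N]] `|`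
     [set variable F j | j in [set j : 'I_r | (q <= j)%N]] `|`
     [set g | exists (j : 'I_r) (v : multinom r),
        [/\ (p <= j < q)%N, msupport v `<=` [set i : 'I_r | (i < p)%N],
            (mdeg v)%:Z = - ell j & g = mpolyX F v * variable F j]]).
Proof.
have HE a : holomorphy_monoid f s0 a <-> 0 <= weight ell a.
  apply/has_order_holomorphicP/has_order_prod => j.
  exact/has_orderX/ell_ord.
have ge0_split (j : 'I_r) : 0 <= ell j -> (j < p)%N \/ (q <= j)%N.
  case: (ltnP j p) => [|pj]; first by left.
  case: (leqP q j) => [|jq]; first by right.
  by rewrite leNgt ell_neg ?pj.
have lt0_split (j : 'I_r) : ell j < 0 -> (p <= j < q)%N.
  move=> j0; rewrite leqNgt [X in _ && X]ltnNge.
  apply/andP; split; apply/negP.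
    by move=> /ell_pos jpos; have := lt_trans j0 jpos; rewrite ltxx.
  by move=> /ell_zero jE; rewrite jE ltxx in j0.
have gt0_split (j : 'I_r) : 0 < ell j -> (j < p)%N.
  move=> j0; case: (ge0_split _ (ltW j0)) => // /ell_zero jE.
  by rewrite jE ltxx in j0.
set S := (X in generated_subalgebra X).
have Sclosed := generated_subalgebra_subalg_closed S.
apply/seteqP; split.
  apply: smallest_sub => [|_ [a /HE wa <-]]; first exact: subalg_submod_closed.
  have [S1 _ SM] := Sclosed.
  have SX (g : mpoly r F) : S g -> generated_subalgebra S g.
    exact: sub_gen_smallest.
  move: a wa; apply: weight_monoid_ind.
  - by move=> j /gt0_split; exact: simple_zeros.
  - by rewrite mpolyX0 -in_setE.
  - by move=> a b Sa Sb; rewrite mpolyXD -in_setE; apply: SM; rewrite in_setE.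
  - move=> j /ge0_split[jp|qj]; apply: SX; left; [left|right]; by exists j.
  - move=> j v /lt0_split jpq vpos vd; apply: SX; right.
    exists j, v; split=> //; last by rewrite mpolyXD.
    by move=> i /vpos/gt0_split.
apply: smallest_sub.
  apply: monomial_span_subalg_closed => [|a b].
    by apply/HE; rewrite weight0.
  by move=> /HE wa /HE wb; apply/HE; rewrite weightD addr_ge0.
have HU j : 0 <= ell j ->
    monomial_span F (holomorphy_monoid f s0) (variable F j).
  by move=> j0; apply: mpolyX_monomial_span; apply/HE; rewrite weightU.
move=> _ [[[j /= jp <-]|[j /= qj <-]]|[j [v [jpq vp vd ->]]]].
- by apply: HU; apply: ltW; exact: ell_pos.
- by apply: HU; rewrite ell_zero.
- rewrite -mpolyXD; apply: mpolyX_monomial_span; apply/HE.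
  rewrite weightD weightU weight_eq_mdeg ?vd ?addNr// => i.
  by move=> /vp; exact: simple_zeros.
Qed.
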